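(* Let $n\ge 1$ be an integer, let $\rho=(\kappa-1)/(\kappa+1)\in(0,1)$ with $\kappa=L/\mu$, let $M_\rho\in\mathbb{R}^{n\times n}$ be the matrix with all entries of the first row equal to $\rho/n$, entries $(i+1,i)$ equal to $1$ for $i=1,\dots,n-1$, and all other entries $0$, and let $\lambda^*(\rho)$ be the spectral radius of $M_\rho$. Let $T(\lambda)=\lambda^n-\frac{\rho}{n}\lambda^{n-1}-\frac{\rho}{n}\lambda^{n-2}-\dots-\frac{\rho}{n}$ be the characteristic polynomial of $M_\rho$. Let $(d^k)_{k\ge0}$ be defined by $d^j=\|x^j-x^*\|$ for $j=0,\dots,n-1$ and $$d^{k+1}=\rho\,\frac{d^k+d^{k-1}+\dots+d^{k-n+1}}{n}\quad\text{for } k\ge n-1,$$ where $(x^k)$ is the sequence generated by the DIAG method with stepsize $\epsilon=2/(\mu+L)$. Then: (i) $\lambda^*(\rho)$ is the largest real root of the characteristic polynomial $T(\lambda)$. Furthermore, it is a simple root. (ii) $\lim_{k\to\infty} d^{k+1}/d^k=\lambda^*(\rho)$. (iii) For integers $n>1$, $\rho\le\lambda^*(\rho)<\sqrt[n]{\rho}$. (iv) $\lambda^*(\rho)=\gamma_0$, where $\gamma_0$ is the largest real root in the interval $[0,1)$ of the polynomial $h(\lambda)=\lambda^{n+1}-\left(1+\frac{\rho}{n}\right)\lambda^n+\frac{\rho}{n}$.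
   Context: $\|\cdot\|$ is the Euclidean norm. Setting: $\mu>0$, $L<\infty$, and $f_1,\dots,f_n:\mathbb{R}^p\to\mathbb{R}$ are differentiable, $\mu$-strongly convex ($(\nabla f_i(x)-\nabla f_i(y))^T(x-y)\ge \mu\|x-y\|^2$ for all $x,y$) with $L$-Lipschitz gradients ($\|\nabla f_i(x)-\nabla f_i(y)\|\le L\|x-y\|$ for all $x,y$); $x^*$ is the minimizer of $f=\frac1n\sum_{i=1}^n f_i$. DIAG (Double Incremental Aggregated Gradient) method with stepsize $\epsilon$: given $x^0\in\mathbb{R}^p$, set $y_1^0=\dots=y_n^0=x^0$. For $k=0,1,2,\dots$, let $i^k=(k \bmod n)+1$, compute $$x^{k+1}=\frac1n\sum_{i=1}^n y_i^k-\frac{\epsilon}{n}\sum_{i=1}^n\nabla f_i(y_i^k),$$ and set $y_{i^k}^{k+1}=x^{k+1}$ and $y_i^{k+1}=y_i^k$ for $i\ne i^k$. *)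

(* Defs.v *)
From HB Require Import structures.
From mathcomp Require Import all_boot all_order all_algebra.
From mathcomp Require Import complex.
From mathcomp Require Import all_classical all_reals all_analysis.

Set Implicit Arguments.
Unset Strict Implicit.
Unset Printing Implicit Defensive.

Import Order.TTheory GRing.Theory Num.Theory.
Import numFieldNormedType.Exports.

Local Open Scope ring_scope.
Local Open Scope classical_set_scope.

Definition dotv (R : realType) (p : nat) (u v : 'rV[R]_p) : R :=
  \sum_(j < p) u 0 j * v 0 j.

(* The library norm on 'rV[R]_p is the sup norm, hence this one; the two induce
   the same topology, so the library's [differentiable] is the usual notion. *)
Definition enorm (R : realType) (p : nat) (u : 'rV[R]_p) : R :=
  Num.sqrt (dotv u u).

Definition gradient (R : realType) (p : nat) (f : 'rV[R]_p -> R)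
    (x : 'rV[R]_p) : 'rV[R]_p :=
  \row_(j < p) 'D_(delta_mx 0 j) f x.

Definition strongly_convex (R : realType) (p : nat) (mu : R)
    (f : 'rV[R]_p -> R) : Prop :=
  forall x y : 'rV[R]_p,
    mu * enorm (x - y) ^+ 2 <= dotv (gradient f x - gradient f y) (x - y).

Definition lipschitz_gradient (R : realType) (p : nat) (L : R)
    (f : 'rV[R]_p -> R) : Prop :=
  forall x y : 'rV[R]_p,
    enorm (gradient f x - gradient f y) <= L * enorm (x - y).

Definition average (R : realType) (n p : nat) (f : 'I_n -> 'rV[R]_p -> R)
    (x : 'rV[R]_p) : R :=
  n%:R^-1 * \sum_(i < n) f i x.

Definition is_minimizer (R : realType) (p : nat) (f : 'rV[R]_p -> R)
    (x : 'rV[R]_p) : Prop :=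
  forall y : 'rV[R]_p, f x <= f y.

Section DIAG.
Variables (R : realType) (n p : nat) (f : 'I_n -> 'rV[R]_p -> R).
Variables (eps : R) (x0 : 'rV[R]_p).

Definition diag_step (y : 'I_n -> 'rV[R]_p) : 'rV[R]_p :=
  n%:R^-1 *: (\sum_(i < n) y i)
  - (eps / n%:R) *: (\sum_(i < n) gradient (f i) (y i)).

(* Component functions are indexed from 0, so the one refreshed at step k has
   index k %% n. *)
Fixpoint diag_y (k : nat) : 'I_n -> 'rV[R]_p :=
  if k is k'.+1 then
    fun i => if (i == k' %% n :> nat)%N then diag_step (diag_y k')
             else diag_y k' i
  else fun=> x0.

Definition diag_x (k : nat) : 'rV[R]_p :=
  if k is k'.+1 then diag_step (diag_y k') else x0.

End DIAG.

(* The eigenvalues are the complex ones; for n > 0 the set is finite and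
   nonempty, so the supremum is a maximum. *)
Definition spectral_radius (R : realType) (n : nat) (A : 'M[R]_n) : R :=
  sup [set complex.Re `|z| | z in
        [set z : R[i] | eigenvalue (map_mx (real_complex R) A) z]].

Definition M_mx (R : realType) (n : nat) (rho : R) : 'M[R]_n :=
  \matrix_(i < n, j < n)
    if i == 0%N :> nat then rho / n%:R
    else if i == j.+1 :> nat then 1 else 0.

Definition T_poly (R : realType) (n : nat) (rho : R) : {poly R} :=
  'X^n - \sum_(i < n) (rho / n%:R) *: 'X^i.

Definition h_poly (R : realType) (n : nat) (rho : R) : {poly R} :=
  'X^(n.+1) - (1 + rho / n%:R) *: 'X^n + (rho / n%:R)%:P.

Definition largest_root_in (R : realType) (A : set R) (q : {poly R}) (x : R)
    : Prop :=
  [/\ A x, root q x & forall y : R, A y -> root q y -> y <= x].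

(* Main.v *)
(* With c = rho / n, T has a unique positive root gamma, because
   c * sum_(i<n) x^(i-n) is strictly decreasing; it lies in (0,1), and any eigenvalue z satisfies T(|z|) <= 0 by
   the triangle inequality, so gamma is the spectral radius. Dividing d_k by
   gamma^k turns the recurrence into one where each term is a weighted average
   of the n previous ones; such a positive sequence converges to a positive
   limit, so consecutive ratios of d tend to gamma. The roots of h other than 1
   are those of T since h = (x - 1) T. *)
Require Import Defs.
From HB Require Import structures.
From mathcomp Require Import all_boot all_order all_algebra.
From mathcomp Require Import complex.
From mathcomp Require Import all_classical all_reals all_analysis.
From mathcomp Require Import fingroup perm ring zify.

Set Implicit Arguments.
Unset Strict Implicit.
Unset Printing Implicit Defensive.

Import Order.TTheory GRing.Theory Num.Theory.
Import numFieldNormedType.Exports.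

Local Open Scope ring_scope.
Local Open Scope classical_set_scope.

(** * Positive roots of [T_poly]: uniqueness, existence, simplicity *)

Lemma T_polyE (R : realType) n (rho x : R) :
  (T_poly n rho).[x] = x ^+ n - rho / n%:R * \sum_(i < n) x ^+ i.
Proof.
rewrite /T_poly hornerD hornerN hornerXn horner_sum mulr_sumr; congr (_ - _).
by apply: eq_bigr => i _; rewrite hornerZ hornerXn.
Qed.

Lemma root_T_polyE (R : realType) n (rho x : R) :
  root (T_poly n rho) x = (x ^+ n == rho / n%:R * \sum_(i < n) x ^+ i).
Proof. by rewrite rootE T_polyE subr_eq0. Qed.

(** Multiplying by [a ^+ n] and using the root equation at [a] reduces the claim to
    [a ^+ n * x ^+ i < x ^+ n * a ^+ i] for each [i < n], that is, to
    [a ^+ (n - i) < x ^+ (n - i)]. *)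
Lemma T_poly_gt0 (R : realType) n (rho a x : R) :
  0 < rho / n%:R -> 0 < a -> a < x -> root (T_poly n rho) a ->
  0 < (T_poly n rho).[x].
Proof.
case: n => [|n] c0 a0 ax; first by rewrite invr0 mulr0 ltxx in c0.
have x0 := lt_trans a0 ax.
rewrite root_T_polyE T_polyE subr_gt0 => /eqP Ta.
rewrite -(ltr_pM2l (exprn_gt0 n.+1 a0)) [ltRHS]mulrC [in ltRHS]Ta.
rewrite mulrCA [ltRHS]mulrCA ltr_pM2l // !mulr_sumr.
apply: ltr_sum => [|i _]; first by apply/hasP; exists ord0; rewrite ?mem_index_enum.
have expE z : z ^+ n.+1 = z ^+ (n.+1 - i) * z ^+ i :> R.
  by rewrite -exprD subnK // ltnW.
rewrite !expE -2!mulrA.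
rewrite [x ^+ i * a ^+ i]mulrC ltr_pM2r ?mulr_gt0 ?exprn_gt0 //.
by rewrite ltrXn2r ?ltW // -lt0n subn_gt0.
Qed.

Lemma T_poly_root_exists (R : realType) n (rho : R) :
  (0 < n)%N -> 0 < rho < 1 ->
  exists2 g : R, 0 < g < 1 & root (T_poly n rho) g.
Proof.
case: n => // n _ /andP[r0 r1].
have T0 : (T_poly n.+1 rho).[0] < 0.
  rewrite T_polyE big_ord_recl expr0 big1 ?addr0 => [|i _]; last first.
    by rewrite exprS mul0r.
  by rewrite exprS mul0r sub0r mulr1 oppr_lt0 divr_gt0.
have T1 : 0 < (T_poly n.+1 rho).[1].
  rewrite T_polyE expr1n (eq_bigr (fun=> 1)) => [|i _]; last by rewrite expr1n.
  by rewrite sumr_const card_ord mulfVK ?pnatr_eq0 // subr_gt0.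
have /poly_ivt : (T_poly n.+1 rho).[0] <= 0 <= (T_poly n.+1 rho).[1].
  by rewrite !ltW.
case=> // g /andP[g0 g1] rg; exists g => //.
move/eqP: rg => Tg; rewrite !lt_neqAle g0 g1 !andbT; apply/andP; split.
  by apply: contraTneq T0 => E; rewrite [X in _.[X]]E Tg ltxx.
by apply: contraTneq T1 => <-; rewrite Tg ltxx.
Qed.

(** With [c = rho / n], the root equation gives [g * T'(g) = c * \sum_i (n - i) * g ^+ i], which is
    positive, whereas a multiple root would annihilate the derivative. *)
Lemma T_poly_root_simple (R : realType) n (rho g : R) :
  0 < rho / n%:R -> 0 < g -> root (T_poly n rho) g ->
  mup g (T_poly n rho) = 1%N.
Proof.
case: n => [|n] c0 g0 Tg; first by rewrite invr0 mulr0 ltxx in c0.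
have T0 : T_poly n.+1 rho != 0.
  apply/eqP => E; have := T_poly_gt0 c0 g0 (ltr_pwDr ltr01 (lexx g)) Tg.
  by rewrite E horner0 ltxx.
apply/eqP; rewrite eqn_leq mup_leq // mup_geq // expr1 dvdp_XsubCl Tg andbT.
apply/negP => /dvdpP[q Eq].
have : (T_poly n.+1 rho)^`().[g] = 0.
  rewrite Eq expr2 mulrA derivM hornerD !hornerM !hornerXsubC subrr.
  by rewrite !mulr0 mul0r addr0.
rewrite /T_poly derivB derivXn raddf_sum /= !hornerE hornerMn hornerXn.
move=> /(congr1 ( *%R g)); rewrite mulr0 mulrBr mulrnAr -exprS.
move: Tg; rewrite root_T_polyE => /eqP ->; rewrite horner_sum mulr_sumr.
rewrite mulr_sumr -sumrMnl -sumrB => /eqP; apply/negP/lt0r_neq0.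
rewrite big_ord_recl; apply: ltr_pwDl.
  rewrite /= derivZ derivXn mulr0n scaler0 horner0 mulr0 subr0 expr0 mulr1.
  by rewrite pmulrn_lgt0.
apply: sumr_ge0 => i _; rewrite derivZ derivXn hornerZ hornerMn hornerXn lift0 /=.
rewrite mulrCA mulrnAr -exprS -mulrnAr -mulrBr -mulrnBr; last by rewrite ltnS ltnW.
by rewrite mulr_ge0 ?mulrn_wge0 ?exprn_ge0 ?(ltW g0) ?(ltW c0).
Qed.

(** * Convergence of sequences defined by weighted averages *)

Lemma averaging_ge (R : realType) m (v : 'I_m.+1 -> R) (u : nat -> R) N a :
  (forall i, 0 <= v i) -> \sum_i v i = 1 ->
  (forall k, u (k + m.+1)%N = \sum_i v i * u (k + i)%N) ->
  (forall i, (i <= m)%N -> a <= u (N + i)%N) ->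
  forall k, (N <= k)%N -> a <= u k.
Proof.
move=> v0 v1 uE ua k; elim/ltn_ind: k => k IH Nk.
have [km|mk] := leqP k (N + m); first by rewrite -(subnKC Nk) ua // leq_subLR.
have mk' : (m.+1 <= k)%N by rewrite (leq_trans _ mk) // ltnS leq_addl.
rewrite -(subnK mk') uE -[a]mul1r -v1 mulr_suml.
apply: ler_sum => i _; apply: ler_wpM2l => //; apply: IH.
  by rewrite -[ltnRHS](subnK mk') ltn_add2l.
by rewrite (leq_trans _ (leq_addr _ _)) // leq_subRL // addnC addnS.
Qed.

(* Only the weight of the most recent term matters: it carries an excess over
   the lower bound through a full window. *)
Lemma averaging_improve (R : realType) m (v : 'I_m.+1 -> R) (u : nat -> R) N a :
  (forall i, 0 <= v i) -> \sum_i v i = 1 ->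
  (forall k, u (k + m.+1)%N = \sum_i v i * u (k + i)%N) ->
  (forall k, (N <= k)%N -> a <= u k) ->
  forall k, (N + m <= k)%N ->
    a + v ord_max ^+ m * (u (N + m)%N - a) <= u k.
Proof.
move=> v0 v1 uE ua; set w := v ord_max; set s := u (N + m)%N.
have vmE : \sum_(i < m) v (widen_ord (leqnSn m) i) = 1 - w.
  by rewrite -v1 big_ord_recr /= addrK.
have w1 : w <= 1 by rewrite -subr_ge0 -vmE sumr_ge0.
have sa : 0 <= s - a by rewrite subr_ge0 ua // leq_addr.
have step i : a + w ^+ i * (s - a) <= u (N + m + i)%N.
  elim: i => [|i IH]; first by rewrite expr0 mul1r addn0 addrC subrK.
  have -> : (N + m + i.+1 = N + i + m.+1)%N by rewrite !addnS addnAC.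
  rewrite uE big_ord_recr /= -/w.
  (* The most recent term, of weight [w], keeps its excess over [a]; the older ones, of total weight
     [1 - w], are only bounded by [a]. *)
  have -> : a + w ^+ i.+1 * (s - a) = (1 - w) * a + w * (a + w ^+ i * (s - a)).
    by rewrite exprS; ring.
  apply: lerD; last by rewrite ler_wpM2l ?v0 // addnAC.
  rewrite -vmE mulr_suml; apply: ler_sum => j _.
  by rewrite ler_wpM2l // ua // -addnA leq_addr.
(* As [w <= 1], the bound with exponent [m] is the weakest of those on the window, so it holds on
   all of it and then persists. *)
apply: (averaging_ge v0 v1 uE) => i im; apply: le_trans (step i).
by rewrite lerD2l ler_wpM2r // ler_wiXn2l // v0.
Qed.

(** Applying the improvement to [u] and to [- u] at the same value [s] raises [a] by
    [w ^+ m * (s - a)] and lowers [b] by [w ^+ m * (b - s)]; the two gains add up to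
    [w ^+ m * (b - a)] whatever [s] is. *)
Lemma averaging_contract (R : realType) m (v : 'I_m.+1 -> R) (u : nat -> R)
    N a b :
  (forall i, 0 <= v i) -> \sum_i v i = 1 ->
  (forall k, u (k + m.+1)%N = \sum_i v i * u (k + i)%N) ->
  (forall k, (N <= k)%N -> a <= u k <= b) ->
  exists a' b', b' - a' = (1 - v ord_max ^+ m) * (b - a) /\
    forall k, (N + m <= k)%N -> a' <= u k <= b'.
Proof.
move=> v0 v1 uE uab; set w := v ord_max; set s := u (N + m)%N.
exists (a + w ^+ m * (s - a)), (b - w ^+ m * (b - s)); split; first by ring.
have uE' k : - u (k + m.+1)%N = \sum_i v i * - u (k + i)%N.
  by rewrite uE -sumrN; apply: eq_bigr => i _; rewrite mulrN.
move=> k Nk; apply/andP; split.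
  by apply: (@averaging_improve _ m v u N a) => // j /uab /andP[].
have -> : b - w ^+ m * (b - s) = - (- b + w ^+ m * (- s - - b)) by ring.
rewrite lerNr; apply: (@averaging_improve _ m v (fun k => - u k) N (- b)) => //.
move=> j /uab /andP[_].
by rewrite lerN2.
Qed.

Lemma prefix_gt0_lower (R : realType) (u : nat -> R) n :
  (forall i, 0 < u i) -> exists2 a, 0 < a & forall i, (i < n)%N -> a <= u i.
Proof.
move=> u0; elim: n => [|n [a a0 ua]]; first by exists 1.
exists (Num.min a (u n)); first by rewrite lt_min a0 u0.
move=> i; rewrite ltnS leq_eqVlt => /orP[/eqP ->|/ua ai].
  by rewrite ge_min lexx orbT.
by rewrite ge_min ai.
Qed.

Lemma prefix_upper (R : realType) (u : nat -> R) n :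
  exists b, forall i, (i < n)%N -> u i <= b.
Proof.
elim: n => [|n [b ub]]; first by exists 0.
exists (Num.max b (u n)) => i; rewrite ltnS leq_eqVlt => /orP[/eqP ->|/ub bi].
  by rewrite le_max lexx orbT.
by rewrite le_max bi.
Qed.

(** Repeated contraction makes the oscillation of the tails decay geometrically, so [u] is Cauchy;
    the minimum over the first window bounds the limit away from 0. *)
Lemma averaging_cvg (R : realType) m (v : 'I_m.+1 -> R) (u : nat -> R) :
  (forall i, 0 <= v i) -> 0 < v ord_max -> \sum_i v i = 1 ->
  (forall k, u (k + m.+1)%N = \sum_i v i * u (k + i)%N) ->
  (forall k, 0 < u k) ->
  exists2 l : R, 0 < l & u @ \oo --> l.
Proof.
move=> v0 w0 v1 uE u0; set w := v ord_max in w0.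
have w1 : w <= 1.
  by rewrite -v1 big_ord_recr /= lerDr sumr_ge0.
have [a a0 ua] := prefix_gt0_lower m.+1 u0.
have [b ub] := prefix_upper u m.+1.
have ua' k : a <= u k by apply: (averaging_ge v0 v1 uE (N := 0)).
have ub' k : u k <= b.
  rewrite -lerN2; apply: (averaging_ge (u := -%R \o u) v0 v1 _ (N := 0)) => //=.
    by move=> j; rewrite uE -sumrN; apply: eq_bigr => i _; rewrite mulrN.
  by move=> i im; rewrite lerN2 ub.
have osc t : exists N a' b', b' - a' = (1 - w ^+ m) ^+ t * (b - a) /\
    forall k, (N <= k)%N -> a' <= u k <= b'.
  elim: t => [|t [N [a' [b' [E H]]]]].
    by exists 0%N, a, b; rewrite mul1r; split => // k _; rewrite ua' ub'.
  have [a2 [b2 [E2 H2]]] := averaging_contract v0 v1 uE H.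
  by exists (N + m)%N, a2, b2; rewrite E2 E exprS mulrA.
have cv : cvg (u @ \oo).
  apply: cauchy_cvg; apply: cauchy_exP => e e0.
  have : (fun t => (1 - w ^+ m) ^+ t * (b - a)) @ \oo --> 0 * (b - a).
    apply: cvgMl; apply: cvg_expr.
    have wm1 : 0 <= 1 - w ^+ m by rewrite subr_ge0 exprn_ile1 // ltW.
    by rewrite ger0_norm // gtrBl exprn_gt0.
  rewrite mul0r => /cvgrPdist_lt /(_ e e0) [t _ /(_ t (leqnn t))] /=.
  rewrite sub0r normrN => te.
  have [N [a' [b' [E H]]]] := osc t.
  exists a'; exists N => // k /= Nk; rewrite /ball /=.
  have /andP[h1 h2] := H k Nk.
  rewrite distrC ger0_norm ?subr_ge0 //.
  apply: le_lt_trans te; apply: le_trans (ler_norm _).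
  by rewrite -E lerD2r.
exists (lim (u @ \oo)) => //; apply: lt_le_trans a0 _.
by apply: limr_ge => //; apply: nearW.
Qed.

(** * Characteristic polynomial and spectral radius of [M_mx] *)

(** The sign of [s] appears once for the rows and once for the columns, and cancels. *)
Lemma det_reindex (R : comNzRingType) n (s : {perm 'I_n}) (A : 'M[R]_n) :
  \det (\matrix_(i, j) A (s i) (s j)) = \det A.
Proof.
have -> : \matrix_(i, j) A (s i) (s j) = row_perm s (col_perm s A).
  by apply/matrixP => i j; rewrite !mxE.
rewrite row_permE col_permE !det_mulmx !det_perm odd_permV mulrCA.
by rewrite -signr_addb addbb mulr1.
Qed.

Lemma size_T_poly (R : realType) n (rho : R) : size (T_poly n rho) = n.+1.
Proof.
rewrite /T_poly size_polyDl size_polyXn // size_polyN ltnS.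
by rewrite -(poly_def n (fun=> rho / n%:R)) size_poly.
Qed.

Lemma T_poly_monic (R : realType) n (rho : R) : T_poly n rho \is monic.
Proof.
rewrite monicE lead_coefDl ?lead_coefXn // size_polyXn size_polyN ltnS.
by rewrite -(poly_def n (fun=> rho / n%:R)) size_poly.
Qed.

Lemma coef_T_poly (R : realType) n (rho : R) i :
  (i < n)%N -> (T_poly n rho)`_i = - (rho / n%:R).
Proof.
move=> i_n; rewrite /T_poly -(poly_def n (fun=> rho / n%:R)).
by rewrite coefB coefXn coef_poly i_n ltn_eqF // sub0r.
Qed.

(* Reversing the order of the basis turns [M_mx] into the companion matrix of
   [T_poly]. *)
Lemma char_poly_M_mx (R : realType) n (rho : R) :
  char_poly (M_mx n rho) = T_poly n rho.
Proof.
rewrite -[RHS]companionmxK ?T_poly_monic // /companionmx size_T_poly /=.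
rewrite /char_poly -[RHS](det_reindex (perm (@rev_ord_inj n))).
congr (\det _); apply/matrixP => i j; rewrite !mxE !permE.
rewrite (inj_eq rev_ord_inj) /=; congr (_ - _%:P).
have i_n := ltn_ord i; have j_n := ltn_ord j.
rewrite coef_T_poly ?rev_ord_proof // opprK.
have -> : (n - i.+1 == n.-1)%N = (i == 0%N :> nat) by lia.
have -> : ((n - i.+1).+1 == n - j.+1)%N = (i == j.+1 :> nat) by lia.
by case: (i == j.+1 :> nat).
Qed.

Lemma spectral_radius_M_mx (R : realType) n (rho g : R) :
  0 < rho / n%:R -> 0 < g -> root (T_poly n rho) g ->
  spectral_radius (M_mx n rho) = g.
Proof.
move=> c0 g0 Tg; set c := rho / n%:R in c0.
have eigE z : eigenvalue (map_mx (real_complex R) (M_mx n rho)) z =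
    (z ^+ n == real_complex R c * \sum_(i < n) z ^+ i).
  rewrite eigenvalue_root_char -map_char_poly char_poly_M_mx rootE.
  rewrite /T_poly rmorphB rmorph_sum /= map_polyXn hornerD hornerN hornerXn.
  rewrite horner_sum mulr_sumr subr_eq0; congr (_ == _).
  by apply: eq_bigr => i _; rewrite map_polyZ map_polyXn hornerZ hornerXn.
have bound z : eigenvalue (map_mx (real_complex R) (M_mx n rho)) z ->
    complex.Re `|z| <= g.
  rewrite eigE leNgt => /eqP Ez; apply/negP => gz.
  (* A modulus beyond [g] would make [T_poly] positive there, against the triangle inequality
     applied to the eigenvalue equation [Ez]. *)
  have := T_poly_gt0 c0 g0 gz Tg; rewrite T_polyE -/c subr_gt0 ltNge => /negP.
  apply; rewrite -lecR rmorphM rmorph_sum rmorphXn /=.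
  have -> : real_complex R (complex.Re `|z|) = `|z|.
    by rewrite RRe_real // normr_real.
  rewrite -normrX Ez normrM (ger0_norm (_ : 0 <= real_complex R c)) ?ler0c ?(ltW c0) //.
  rewrite ler_wpM2l ?ler0c ?(ltW c0) //.
  apply: le_trans (ler_norm_sum _ _ _) _.
  by apply: ler_sum => i _; rewrite rmorphXn normrX.
have attained : complex.Re `|real_complex R g| = g.
  by rewrite ger0_norm ?ler0c ?ltW.
have g_eig : eigenvalue (map_mx (real_complex R) (M_mx n rho)) (real_complex R g).
  rewrite eigE -rmorphXn /=; move: Tg; rewrite root_T_polyE -/c => /eqP ->.
  rewrite rmorphM rmorph_sum; apply/eqP; congr (_ * _).
  by apply: eq_bigr => i _; rewrite rmorphXn.
(* [sup] is meaningful only on a nonempty bounded set: [g_eig] gives nonemptiness and [bound] the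
   upper bound. *)
apply/eqP; rewrite eq_le; apply/andP; split.
  by apply: ge_sup => [|_ [z /= /bound zg <-//]]; exists g, (real_complex R g).
apply: ub_le_sup; last by exists (real_complex R g).
by exists g => _ [z /= /bound zg <-].
Qed.

(** * The factorization of [h_poly] and the bounds on the root *)

Lemma h_polyE (R : realType) n (rho x : R) :
  (0 < n)%N -> (h_poly n rho).[x] = (x - 1) * (T_poly n rho).[x].
Proof.
move=> n0; rewrite T_polyE /h_poly !hornerD hornerN hornerZ !hornerXn hornerC.
rewrite mulrBr mulrCA -subrX1 exprS; ring.
Qed.

(** Since [g < 1], each of the [n] powers in the root equation is at least [g ^+ (n - 1)], so
    [g ^+ n >= rho * g ^+ (n - 1)]. *)
Lemma ge_T_poly_root (R : realType) n (rho g : R) : (0 < n)%N ->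
  0 < rho -> 0 < g < 1 -> root (T_poly n rho) g -> rho <= g.
Proof.
case: n => // n _ r0 /andP[g0 g1]; rewrite root_T_polyE => /eqP Tg.
rewrite -(ler_pM2r (exprn_gt0 n g0)) -exprS Tg -mulrA ler_wpM2l ?(ltW r0) //.
rewrite ler_pdivlMl // mulr_natl -[in leLHS](card_ord n.+1) -sumr_const.
by apply: ler_sum => i _; rewrite ler_wiXn2l ?(ltW g0) ?(ltW g1) // -ltnS.
Qed.

(** Comparing [n]-th powers, it suffices that the powers [g ^+ i] have mean below 1; strictness
    comes from the last one, whose exponent [n - 1] is positive. *)
Lemma T_poly_root_lt (R : realType) n (rho g : R) : (1 < n)%N ->
  0 < rho -> 0 < g < 1 -> root (T_poly n rho) g -> g < rho `^ (n%:R^-1).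
Proof.
case: n => [|[|n]] // _ r0 /andP[g0 g1]; rewrite root_T_polyE => /eqP Tg.
rewrite -(@ltr_pXn2r _ n.+2) ?nnegrE ?powR_ge0 ?(ltW g0) //.
rewrite -[ltRHS]powR_mulrn ?powR_ge0 // -powRrM mulVf ?pnatr_eq0 // powRr1 ?(ltW r0) //.
rewrite Tg -mulrA gtr_pMr // mulrC ltr_pdivrMr // mul1r.
rewrite -[ltRHS](_ : \sum_(i < n.+2) 1 = _); last by rewrite sumr_const card_ord.
rewrite big_ord_recr [ltRHS]big_ord_recr ler_ltD //=.
  by apply: ler_sum => i _; rewrite exprn_ile1 // ltW.
by rewrite exprn_ilt1 // ltW.
Qed.

(** * Limit of the consecutive ratios *)

Lemma recurrence_ratio_cvg (R : realType) n (rho g : R) (d : nat -> R) :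
  0 < rho / n%:R -> 0 < g -> root (T_poly n rho) g ->
  (forall j, (j < n)%N -> 0 <= d j) -> 0 < d 0%N ->
  (forall k, (n - 1 <= k)%N ->
     d k.+1 = rho * ((\sum_(j < n) d (k - j)%N) / n%:R)) ->
  d k.+1 / d k @[k --> \oo] --> g.
Proof.
case: n => [|m] c0 g0 Tg d_init d0 dE; first by rewrite invr0 mulr0 ltxx in c0.
set c := rho / m.+1%:R in c0.
have rec k : d (k + m.+1)%N = c * \sum_(i < m.+1) d (k + i)%N.
  rewrite addnS dE ?subn1 ?leq_addl // mulrA mulrAC; congr (_ * _).
  rewrite (reindex_inj rev_ord_inj); apply: eq_bigr => i _ /=.
  by congr d; have := ltn_ord i; lia.
have d_ge0 k : 0 <= d k.
  elim/ltn_ind: k => k IH; have [/d_init //|mk] := ltnP k m.+1.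
  rewrite -(subnK mk) rec mulr_ge0 ?(ltW c0) // sumr_ge0 // => i _.
  by rewrite IH // -[ltnRHS](subnK mk) ltn_add2l.
(* Initial values other than [d 0] may vanish, so positivity is claimed only from index [m.+1] on;
   hence the shift in [u]. *)
have d_gt0 k : 0 < d (k + m.+1)%N.
  elim: k => [|k IH]; rewrite rec mulr_gt0 //.
    by rewrite big_ord_recl addn0 ltr_pwDl ?sumr_ge0.
  by rewrite big_ord_recr /= addSnnS ltr_wpDl ?sumr_ge0.
pose u k := d (k + m.+1)%N / g ^+ k.
pose v (i : 'I_m.+1) := c * g ^+ i / g ^+ m.+1.
have v_gt0 i : 0 < v i by rewrite divr_gt0 ?exprn_gt0 // pmulr_rgt0 ?exprn_gt0.
(* This is the root equation at [g] divided by [g ^+ m.+1]. *)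
have v1 : \sum_i v i = 1.
  rewrite -mulr_suml -mulr_sumr; move: Tg; rewrite root_T_polyE => /eqP <-.
  by rewrite divff // lt0r_neq0 // exprn_gt0.
have g_neq0 k : g ^+ k != 0 by rewrite lt0r_neq0 // exprn_gt0.
have uE k : u (k + m.+1)%N = \sum_i v i * u (k + i)%N.
  rewrite /u rec mulr_sumr mulr_suml; apply: eq_bigr => i _.
  by rewrite /v addnAC !exprD; field; rewrite !g_neq0.
have u_gt0 k : 0 < u k by rewrite /u divr_gt0 ?exprn_gt0.
have [l l0 ul] := averaging_cvg (fun i => ltW (v_gt0 i)) (v_gt0 _) v1 uE u_gt0.
rewrite -(cvg_shiftn m.+1) /=.
have -> : (fun k => d (k + m.+1).+1 / d (k + m.+1)%N) =
          (fun k => g * (u (k + 1)%N / u k)).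
  apply/funext => k; rewrite /u addn1 addSn exprS; field.
  by rewrite g_neq0 !lt0r_neq0.
suff : g * (u (k + 1)%N / u k) @[k --> \oo] --> g * (l / l).
  by rewrite divff ?mulr1 // lt0r_neq0.
apply: cvgMr; apply: cvgM; first by rewrite (cvg_shiftn 1 u).
by apply: cvgV => //; rewrite lt0r_neq0.
Qed.

Lemma enorm_gt0 (R : realType) p (u : 'rV[R]_p) : u != 0 -> 0 < enorm u.
Proof.
move=> u0; rewrite sqrtr_gt0 lt0r /dotv sumr_ge0 ?andbT => [|j _]; last first.
  by rewrite -expr2 sqr_ge0.
apply: contraNneq u0 => /eqP; rewrite psumr_eq0 => [/allP s0|j _]; last first.
  by rewrite -expr2 sqr_ge0.
apply/eqP/rowP => j; rewrite mxE.
by have := s0 j (mem_index_enum j); rewrite mulf_eq0 orbb => /eqP.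
Qed.

(** The limit assumes [x0 <> xstar]: started at the minimizer, the iteration stays there, [d]
    vanishes, and all quotients are [0 / 0 = 0]. *)
Theorem theorem9 (R : realType) (n p : nat) (mu L kappa rho : R)
    (f : 'I_n -> 'rV[R]_p -> R) (xstar x0 : 'rV[R]_p) (d : nat -> R)
    (hn : (1 <= n)%N)
    (hmu : 0 < mu)
    (hdiff : forall (i : 'I_n) (x : 'rV[R]_p), differentiable (f i) x)
    (hconv : forall i : 'I_n, strongly_convex mu (f i))
    (hlip : forall i : 'I_n, lipschitz_gradient L (f i))
    (hmin : is_minimizer (average f) xstar)
    (hkappa : kappa = L / mu)
    (hrho : rho = (kappa - 1) / (kappa + 1))
    (hrho01 : 0 < rho < 1)
    (hd0 : forall j : nat, (j < n)%N ->
       d j = enorm (diag_x f (2 / (mu + L)) x0 j - xstar))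
    (hd : forall k : nat, (n - 1 <= k)%N ->
       d k.+1 = rho * ((\sum_(j < n) d (k - j)%N) / n%:R)) :
  let lambda := spectral_radius (M_mx n rho) in
  [/\ char_poly (M_mx n rho) = T_poly n rho,
      largest_root_in [set: R] (T_poly n rho) lambda
        /\ mup lambda (T_poly n rho) = 1%N,
      x0 <> xstar -> d k.+1 / d k @[k --> \oo] --> lambda,
      (1 < n)%N -> rho <= lambda < rho `^ (n%:R^-1) &
      largest_root_in `[0, 1[ (h_poly n rho) lambda].
Proof.
move=> lambda; have /andP[r0 _] := hrho01.
have c0 : 0 < rho / n%:R by rewrite divr_gt0 // ltr0n.
have [g /andP[g0 g1] Tg] := T_poly_root_exists hn hrho01.
have g01 : 0 < g < 1 by rewrite g0.
have -> : lambda = g by apply: spectral_radius_M_mx.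
have T_le y : root (T_poly n rho) y -> y <= g.
  move=> /rootP Ty; rewrite leNgt; apply/negP => gy.
  by have := T_poly_gt0 c0 g0 gy Tg; rewrite Ty ltxx.
split.
- exact: char_poly_M_mx.
- by split; [split=> // y _; exact: T_le | exact: T_poly_root_simple].
- move=> /eqP x0N; apply: (recurrence_ratio_cvg c0 g0 Tg) hd => [j jn|].
    by rewrite hd0 // sqrtr_ge0.
  by rewrite hd0 // enorm_gt0 // subr_eq0.
- by move=> n1; rewrite (ge_T_poly_root hn r0 g01 Tg) (T_poly_root_lt n1 r0 g01 Tg).
- split; first by rewrite /= in_itv /= ltW.
    by rewrite rootE h_polyE // (rootP Tg) mulr0.
  (* The half-open interval excludes the root 1 of the factor [y - 1]. *)
  move=> y /=; rewrite in_itv /= => /andP[_ y1].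
  rewrite rootE h_polyE // mulf_eq0 subr_eq0 lt_eqF //=.
  exact: T_le.
Qed.
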